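(* Let $m \in \mathbb{N}$, $m \ge 1$, and let $\lambda^1, \dots, \lambda^m : \mathbb{C}^m \to \mathbb{C}$ be functions (not assumed continuous) such that for every $M_m = (a_0,\dots,a_{m-1}) \in \mathbb{C}^m$ the following identity of polynomials in $\lambda$ holds: $$\lambda^m - a_{m-1}\lambda^{m-1} - \cdots - a_1\lambda - a_0 = (\lambda - \lambda^1(M_m)) \cdots (\lambda - \lambda^m(M_m)).$$ Then the function $$\bar\Lambda^m : \mathbb{C}^m \to \mathbb{R}, \quad M_m \mapsto \max\{\operatorname{Re}\lambda^1(M_m), \dots, \operatorname{Re}\lambda^m(M_m)\}$$ is continuous on $\mathbb{C}^m$.
   Context: The functions $\lambda^1,\dots,\lambda^m$ are an arbitrary labelling, at each point $M_m$, of the roots (repeated according to multiplicity) of the monic polynomial with coefficient tuple $M_m$. The value $\bar\Lambda^m(M_m)$ does not depend on the choice of labelling. $\mathbb{C}^m$ carries its standard topology. *)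

(* Defs.v *)
From HB Require Import structures.
From mathcomp Require Import all_boot all_order all_algebra.
From mathcomp Require Import complex.
From mathcomp Require Import boolp classical_sets functions reals topology normedtype.

Set Implicit Arguments.
Unset Strict Implicit.
Unset Printing Implicit Defensive.

Import Order.TTheory GRing.Theory Num.Theory.
Import numFieldNormedType.Exports.

Local Open Scope ring_scope.
Local Open Scope complex_scope.

(* The complex numbers over R, bundled as a numClosedFieldType so that C R gets
   the topology that the library puts on any numFieldType, here the one of the
   modulus; 'rV[C R]_m then carries the product topology. *)
Definition C (R : realType) : numClosedFieldType := R[i].

(* The seed of the iterated maximum is one of its entries, so that this is the
   maximum of the real parts Re (lam i M), i : 'I_m, and of nothing else. *)
Definition max_Re (R : realType) (m : nat) (m_gt0 : (0 < m)%N)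
    (lam : 'I_m -> 'rV[C R]_m -> C R) (M : 'rV[C R]_m) : R :=
  \big[Order.max/complex.Re (lam (Ordinal m_gt0) M)]_(i < m)
    complex.Re (lam i M).

(* Main.v *)
(* If z is a root of the polynomial of M, then the product of the |z - lam i N|
   is the value at z of the difference of the polynomials of N and M.
   That value is small when N is close to M, since the roots are bounded locally
   in M, so some factor is small.
   Hence every root for M is close to a root for N, and, by symmetry, conversely;
   this is enough to compare the maximal real parts, and neither matching the
   roots nor counting multiplicities is needed. *)
Require Import Defs.
From HB Require Import structures.
From mathcomp Require Import all_boot all_order all_algebra.
From mathcomp Require Import complex.
From mathcomp Require Import boolp classical_sets functions reals topology normedtype.

Set Implicit Arguments.
Unset Strict Implicit.
Unset Printing Implicit Defensive.

Import Order.TTheory GRing.Theory Num.Theory.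
Import numFieldNormedType.Exports.

Local Open Scope ring_scope.
Local Open Scope complex_scope.

(** When [|z| > 1], every [z ^+ i] with [i < m] has modulus at most [|z| ^+ (m - 1)]; dividing the
    equation by this power bounds [|z|] by the sum alone. *)
Lemma norm_root_le (K : numFieldType) (m : nat) (a : 'I_m -> K) (z : K) :
  z ^+ m = \sum_(i < m) a i * z ^+ i -> `|z| <= 1 + \sum_(i < m) `|a i|.
Proof.
have s_ge0 : 0 <= \sum_(i < m) `|a i| by apply: sumr_ge0.
have [z_le1 _|z_gt1 zm] := real_leP (normr_real z) (real1 K).
  by rewrite (le_trans z_le1)// lerDl.
rewrite -[leLHS]add0r lerD ?ler01//.
case: m => [|m] in a s_ge0 zm *.
  (* In degree 0 the equation would read [1 = 0]. *)
  by move: zm; rewrite big_ord0 expr0 => /eqP; rewrite oner_eq0.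
have zm_gt0 : 0 < `|z| ^+ m by rewrite exprn_gt0 ?(lt_trans ltr01).
rewrite -(ler_pM2r zm_gt0) -exprS -normrX zm mulr_suml.
apply: le_trans (ler_norm_sum _ _ _) _; apply: ler_sum => i _.
by rewrite normrM normrX ler_wpM2l// ler_eXn2l// -ltnS.
Qed.

(** If all [|z - w i|] were at least [e], their product would be at least [e ^+ m]. Since [z] is a
    root for [a], that product is the modulus of the sum of the [(a i - b i) * z ^+ i]. *)
Lemma exists_root_near (K : numFieldType) (m : nat) (a b : 'I_m -> K)
    (w : 'I_m -> K) (z e : K) :
    'X^m - \sum_(i < m) b i *: 'X^i = \prod_(i < m) ('X - (w i)%:P) ->
    z ^+ m = \sum_(i < m) a i * z ^+ i -> 0 < e ->
    \sum_(i < m) `|a i - b i| * `|z| ^+ i < e ^+ m ->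
  exists i, `|z - w i| < e.
Proof.
move=> bw az e_gt0 ab; apply/existsP; apply: contraLR ab => /existsPn far.
have hornerb : \prod_(i < m) (z - w i) = \sum_(i < m) (a i - b i) * z ^+ i.
  have := congr1 (fun p => p.[z]) bw.
  rewrite horner_prod hornerD hornerN hornerXn horner_sum az -sumrB => eq_z.
  transitivity (\prod_(i < m) ('X - (w i)%:P).[z]).
    by apply: eq_bigr => i _; rewrite hornerXsubC.
  by rewrite -eq_z; apply: eq_bigr => i _; rewrite hornerZ hornerXn mulrBl.
have le_em : e ^+ m <= \sum_(i < m) `|a i - b i| * `|z| ^+ i.
  have -> : e ^+ m = \prod_(i < m) e by rewrite prodr_const card_ord.
  apply: (@le_trans _ _ (\prod_(i < m) `|z - w i|)).
    apply: ler_prod => i _; rewrite (ltW e_gt0) /=.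
    by rewrite real_leNgt ?normr_real ?(gtr0_real e_gt0) ?far.
  rewrite -(normr_prod _ _ (fun i => z - w i)) hornerb; apply: le_trans (ler_norm_sum _ _ _) _.
  by apply: ler_sum => i _; rewrite normrM normrX.
by apply/negP => /lt_le_trans/(_ le_em); rewrite ltxx.
Qed.

Lemma root_prod_XsubC_eq (K : fieldType) (m : nat) (a w : 'I_m -> K) (j : 'I_m) :
    'X^m - \sum_(i < m) a i *: 'X^i = \prod_(i < m) ('X - (w i)%:P) ->
  w j ^+ m = \sum_(i < m) a i * w j ^+ i.
Proof.
move=> /(congr1 (fun p => p.[w j])).
rewrite [in RHS](bigD1 j)//= hornerM hornerXsubC subrr mul0r.
rewrite hornerD hornerN hornerXn horner_sum => /eqP; rewrite subr_eq0 => /eqP ->.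
by apply: eq_bigr => i _; rewrite hornerZ hornerXn.
Qed.

(** The real part of a difference is at most its modulus, so one-sided closeness of the roots yields
    a one-sided estimate; continuity uses it in both directions. *)
Lemma max_Re_lt (R : realType) (m : nat) (m_gt0 : (0 < m)%N)
    (lam : 'I_m -> 'rV[C R]_m -> C R) (e : R) (M N : 'rV[C R]_m) :
    (forall j, exists i, `|lam j M - lam i N| < e%:C) ->
  max_Re m_gt0 lam M < max_Re m_gt0 lam N + e.
Proof.
move=> near; have lt_e j : complex.Re (lam j M) < max_Re m_gt0 lam N + e.
  have [i ji] := near j.
  have : complex.Re (lam j M - lam i N) < e.
    rewrite -ltcR; apply: le_lt_trans ji; apply: le_trans (normc_ge_Re _).
    by rewrite lecR ler_norm.
  rewrite raddfB/= ltrBlDl => /lt_le_trans; apply; rewrite lerD2r.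
  exact: (le_bigmax _ (fun i => complex.Re (lam i N))).
exact: bigmax_lt.
Qed.

Theorem lemma1 (R : realType) (m : nat) (m_gt0 : (0 < m)%N)
    (lam : 'I_m -> 'rV[C R]_m -> C R)
    (lamP : forall M : 'rV[C R]_m,
      'X^m - \sum_(i < m) M ord0 i *: 'X^i = \prod_(i < m) ('X - (lam i M)%:P)) :
  continuous (max_Re m_gt0 lam).
Proof.
move=> M; apply/(@cvgrPdist_lt _ _ _ (nbhs M) (nbhs_filter M)) => e e_gt0.
have eC_gt0 : 0 < e%:C :> C R by rewrite ltcR.
(* By [norm_root_le], [B] bounds the roots for every [P] with [|P ord0 i| <= |M ord0 i| + 1]. *)
pose B : C R := 1 + \sum_(i < m) (`|M ord0 i| + 1).
have B_ge1 : 1 <= B by rewrite lerDl sumr_ge0// => i _; rewrite addr_ge0.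
(* As [B >= 1], [A] bounds the sum of the [|z| ^+ i], [i < m], whenever [|z| <= B]. *)
pose A : C R := B ^+ m *+ m.
have A_ge0 : 0 <= A by rewrite mulrn_wge0// exprn_ge0// (le_trans ler01).
have em_gt0 : 0 < e%:C ^+ m :> C R by rewrite exprn_gt0.
have D_gt0 : 0 < e%:C ^+ m + A + 1 by rewrite ltr_wpDl// addr_ge0// ltW.
(* This radius satisfies both [d <= 1], which keeps the roots for [N] within [B], and
   [d * A < e%:C ^+ m], as [exists_root_near] demands. *)
pose d : C R := e%:C ^+ m / (e%:C ^+ m + A + 1).
have d_gt0 : 0 < d by rewrite divr_gt0.
have d_le1 : d <= 1.
  by rewrite ler_pdivrMr// mul1r -addrA lerDl addr_ge0.
have dA : d * A < e%:C ^+ m.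
  rewrite mulrAC ltr_pdivrMr// ltr_pM2l// -addrA addrCA ltrDl.
  by rewrite addr_gt0.
(* Only the coefficients of [P] need the explicit bound, so the claim applies to [(N, M)] and to
   [(M, N)] alike. *)
have roots_near (P Q : 'rV[C R]_m) (j : 'I_m) :
    (forall i, `|P ord0 i| <= `|M ord0 i| + 1) ->
    (forall i, `|P ord0 i - Q ord0 i| < d) ->
    exists i, `|lam j P - lam i Q| < e%:C.
  move=> P_le PQ; have Pj := root_prod_XsubC_eq j (lamP P).
  have z_le : `|lam j P| <= B.
    apply: le_trans (norm_root_le Pj) _; rewrite lerD2l.
    by apply: ler_sum => i _; exact: P_le.
  apply: (exists_root_near (lamP Q) Pj eC_gt0); apply: le_lt_trans dA.
  rewrite /A -[X in _ *+ X]card_ord -sumr_const mulr_sumr.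
  apply: ler_sum => i _; apply: ler_pM => //; first by rewrite exprn_ge0.
    by rewrite ltW.
  apply: le_trans (_ : B ^+ i <= _); first by rewrite lerXn2r ?nnegrE ?(le_trans _ z_le).
  by rewrite ler_weXn2l// ltnW.
apply/nbhs_ballP; exists d => //= N [_ MN].
have {}MN i : `|M ord0 i - N ord0 i| < d by exact: MN.
rewrite ltr_distl ltrBlDr; apply/andP; split; apply: max_Re_lt => j.
  apply: roots_near => i; last by rewrite distrC.
  rewrite -[N ord0 i](subrK (M ord0 i)) addrC (le_trans (ler_normD _ _))//.
  by rewrite lerD2l distrC (le_trans (ltW (MN i))).
by apply: roots_near => // i; rewrite lerDl.
Qed.
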